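(* Let $G$ be a clock-free, diamond-free graph with no star cutset, and let $w$ be a weight function on $G$ such that $G$ has no $(w,\tfrac12)$-balanced separator of size at most $4\omega(G)$. Let $X,X'\in\operatorname{core}_{w,G}(\mathcal{X}(G))$. Then $S_{w,G}(X)$ and $S_{w,G}(X')$ are loosely non-crossing.
   Context: Clock: a hole (induced cycle of length $\ge4$) $C$ plus a vertex outside $C$ with two non-adjacent neighbours in $C$; diamond: four vertices, five edges; clock-free/diamond-free mean no such induced subgraph. A star cutset is a set $X$ with $G\setminus X$ non-empty and disconnected and $X\subseteq N[x]$ for some $x\in X$. $\omega(G)$ is the clique number. A weight function is $w:V(G)\to[0,1]$ with total weight 1; $X$ is a $(w,\tfrac12)$-balanced separator if every component of $G\setminus X$ has weight at most $\tfrac12$. For $X$ not such a separator, $S_{w,G}(X)=(A,C,B)$ where $B$ is the unique component of $G\setminus X$ of weight $>\tfrac12$, $C=X$, $A=V(G)\setminus(B\cup C)$. Separations $(A,C,B),(A',C',B')$ are loosely non-crossing if no path has one end in $A\cap C'$, the other in $A'\cap C$, and interior in $A\cap A'$. For a clique $K$ and a set $Z$ in a diamond-free graph, $c_Z(K)=K$ if $|K|\le1$, and otherwise $c_Z(K)=K\cup(N(x)\cap N(y)\cap Z)$ for any distinct $x,y\in K$ (well defined). For cliques $K_1,K_2$ with $K_1\cup K_2$ not a $(w,\tfrac12)$-balanced separator and $(A,C,B)=S_{w,G}(K_1\cup K_2)$, let $\operatorname{closure}(K_1,K_2)=c_{A\cup C}(K_1\cap N(B))\cup c_{A\cup C}(K_2\cap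 N(B))$. Let $\mathcal{X}(G)=\{\operatorname{closure}(K_1,K_2):K_1,K_2\text{ cliques of }G\}$. For sets $X,X'$ that are not $(w,\tfrac12)$-balanced separators with $S_{w,G}(X)=(A,C,B)$, $S_{w,G}(X')=(A',C',B')$, $X$ is a $(w,G)$-shield for $X'$ if $B\cup C\subsetneq B'\cup C'$, or $B\cup C=B'\cup C'$ and $B'\subsetneq B$. $\operatorname{core}_{w,G}(\mathcal{X})$ is the set of $X'\in\mathcal{X}$ for which no $X\in\mathcal{X}$ is a $(w,G)$-shield for $X'$. *)

(* Defs.v *)
From mathcomp Require Import all_boot all_order all_algebra.
Set Implicit Arguments.
Unset Strict Implicit.
Unset Printing Implicit Defensive.
Import Order.TTheory GRing.Theory Num.Theory.
Local Open Scope ring_scope.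

(* A finite simple graph is given by a finite vertex type T and an adjacency
   relation e : rel T that is symmetric and irreflexive. *)

Definition nbr (T : finType) (e : rel T) (x : T) : {set T} := [set y | e x y].

Definition cnbr (T : finType) (e : rel T) (x : T) : {set T} := x |: nbr e x.

Definition nbr_set (T : finType) (e : rel T) (S : {set T}) : {set T} :=
  [set x | (x \notin S) && [exists y in S, e x y]].

Definition clique (T : finType) (e : rel T) (K : {set T}) : bool :=
  [forall x in K, forall y in K, (x != y) ==> e x y].

Definition clique_number (T : finType) (e : rel T) : nat :=
  (\max_(K : {set T} | clique e K) #|K|)%N.

(* The vertices of the hole are listed in cyclic order; the last clause says
   that the cycle has no chord. *)
Definition hole (T : finType) (e : rel T) (c : seq T) : Prop :=
  [/\ (4 <= size c)%N, uniq c, cycle e c &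
      {in c &, forall x y, e x y -> (y == next c x) || (x == next c y)}].

Definition clock (T : finType) (e : rel T) (c : seq T) (v : T) : Prop :=
  [/\ hole e c, v \notin c &
      exists x y : T, [/\ x \in c, y \in c, x != y, ~~ e x y & e v x && e v y]].

Definition clock_free (T : finType) (e : rel T) : Prop :=
  forall (c : seq T) (v : T), ~ clock e c v.

Definition diamond (T : finType) (e : rel T) (a b c d : T) : bool :=
  [&& uniq [:: a; b; c; d], e a b, e a c, e a d, e b c, e b d & ~~ e c d].

Definition diamond_free (T : finType) (e : rel T) : Prop :=
  forall a b c d : T, ~~ diamond e a b c d.

(* Adjacency in the subgraph induced by S. *)
Definition induced (T : finType) (e : rel T) (S : {set T}) : rel T :=
  [rel x y | [&& e x y, x \in S & y \in S]].

(* Vertex sets of the connected components of the subgraph induced by S. *)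
Definition components (T : finType) (e : rel T) (S : {set T}) : {set {set T}} :=
  [set [set y in S | connect (induced e S) x y] | x in S].

Definition connected (T : finType) (e : rel T) (S : {set T}) : bool :=
  [forall x in S, forall y in S, connect (induced e S) x y].

Definition star_cutset (T : finType) (e : rel T) (X : {set T}) : bool :=
  [&& ~: X != set0, ~~ connected e (~: X) & [exists x in X, X \subset cnbr e x]].

Definition weight_function (R : realFieldType) (T : finType) (w : T -> R) : Prop :=
  (forall x, 0 <= w x <= 1) /\ \sum_x w x = 1.

Definition weight (R : realFieldType) (T : finType) (w : T -> R) (S : {set T}) : R :=
  \sum_(x in S) w x.

Definition balanced_separator (R : realFieldType) (T : finType) (e : rel T)
    (w : T -> R) (X : {set T}) : bool :=
  [forall D in components e (~: X), weight w D <= 2^-1].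

Record separation (T : finType) :=
  Separation { sepA : {set T}; sepC : {set T}; sepB : {set T} }.

(* The component of G \ X of weight > 1/2.  It exists when X is not a balanced
   separator and is then unique, see heavy_componentE; the default value set0
   is irrelevant. *)
Definition heavy_component (R : realFieldType) (T : finType) (e : rel T)
    (w : T -> R) (X : {set T}) : {set T} :=
  odflt set0 [pick D in components e (~: X) | 2^-1 < weight w D].

Definition canonical_separation (R : realFieldType) (T : finType) (e : rel T)
    (w : T -> R) (X : {set T}) : separation T :=
  let B := heavy_component e w X in Separation (~: (B :|: X)) X B.

(* The path is x, q, y, with interior q.  A path with one end in A :&: C' and
   the other in A' :&: C has at least one edge when A and C are disjoint. *)
Definition loosely_non_crossing (T : finType) (e : rel T)
    (s s' : separation T) : Prop :=
  forall (x : T) (q : seq T) (y : T),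
    path e x (rcons q y) -> uniq (x :: rcons q y) ->
    x \in sepA s :&: sepC s' -> y \in sepA s' :&: sepC s ->
    ~ {subset q <= sepA s :&: sepA s'}.

(* c_Z(K).  The pair of distinct vertices of K is arbitrary: the result does
   not depend on it when K is a clique of a diamond-free graph, see
   clique_extensionE.  There is no such pair exactly when #|K| <= 1. *)
Definition clique_extension (T : finType) (e : rel T) (Z K : {set T}) : {set T} :=
  if [pick p : T * T | [&& p.1 \in K, p.2 \in K & p.1 != p.2]] is Some p
  then K :|: (nbr e p.1 :&: nbr e p.2 :&: Z) else K.

Definition closure (R : realFieldType) (T : finType) (e : rel T) (w : T -> R)
    (K1 K2 : {set T}) : {set T} :=
  let s := canonical_separation e w (K1 :|: K2) in
  let Z := sepA s :|: sepC s in
  clique_extension e Z (K1 :&: nbr_set e (sepB s)) :|: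
  clique_extension e Z (K2 :&: nbr_set e (sepB s)).

(* closure K1 K2 is only meaningful when K1 :|: K2 is not a balanced separator. *)
Definition closures (R : realFieldType) (T : finType) (e : rel T)
    (w : T -> R) : {set {set T}} :=
  [set X | [exists K1 : {set T}, exists K2 : {set T},
     [&& clique e K1, clique e K2, ~~ balanced_separator e w (K1 :|: K2) &
         X == closure e w K1 K2]]].

Definition shield (R : realFieldType) (T : finType) (e : rel T) (w : T -> R)
    (X X' : {set T}) : bool :=
  let s := canonical_separation e w X in
  let s' := canonical_separation e w X' in
  [&& ~~ balanced_separator e w X, ~~ balanced_separator e w X' &
      (sepB s :|: sepC s \proper sepB s' :|: sepC s') ||
      (sepB s :|: sepC s == sepB s' :|: sepC s') && (sepB s' \proper sepB s)].

Definition core (R : realFieldType) (T : finType) (e : rel T) (w : T -> R)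
    (F : {set {set T}}) : {set {set T}} :=
  [set X' in F | [forall X in F, ~~ shield e w X X']].

Lemma heavy_componentE (R : realFieldType) (T : finType) (e : rel T)
    (w : T -> R) (X D : {set T}) :
  symmetric e -> weight_function w ->
  D \in components e (~: X) -> 2^-1 < weight w D -> heavy_component e w X = D.
Proof.
move=> e_sym [w01 w1] DX Dw; rewrite /heavy_component.
have c_sym : connect_sym (induced e (~: X)).
  by apply: sym_connect_sym => x y; rewrite /induced /= e_sym [(x \in _) && _]andbC.
case: pickP => [E /andP[EX Ew]|/(_ D)] /=; last by rewrite DX Dw.
case: (boolP [disjoint D & E]) => [dDE|]; last first.
  case/pred0Pn=> z /andP[/=].
  case/imsetP: DX => x _ ->; case/imsetP: EX => y _ ->.
  rewrite !inE => /andP[_ xz] /andP[_ yz]; apply/setP=> u; rewrite !inE.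
  by rewrite (same_connect c_sym xz) (same_connect c_sym yz).
have: weight w (D :|: E) <= 1.
  rewrite -w1 /weight [leRHS](bigID (mem (D :|: E))) /= lerDl sumr_ge0 // => z _.
  by case/andP: (w01 z).
have -> : weight w (D :|: E) = weight w D + weight w E.
  by rewrite /weight -bigU //=; apply: eq_bigl => z; rewrite !inE.
by rewrite leNgt [X in X < _](splitr 1) !mul1r ltrD.
Qed.

Lemma clique_extensionE (T : finType) (e : rel T) (Z K : {set T}) (x y : T) :
  symmetric e -> irreflexive e -> diamond_free e -> clique e K ->
  x \in K -> y \in K -> x != y ->
  clique_extension e Z K = K :|: (nbr e x :&: nbr e y :&: Z).
Proof.
move=> e_sym e_irr Gd /forall_inP Kc xK yK xy.
have Ke u v : u \in K -> v \in K -> u != v -> e u v.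
  by move=> uK vK; move/forall_inP: (Kc u uK) => /(_ v vK) /implyP.
have Kt u v z t : u \in K -> v \in K -> u != v -> z \in K -> t \notin K ->
    e u t -> e v t -> e z t.
  move=> uK vK uv zK tK ut vt.
  have [-> //|zu] := eqVneq z u; have [-> //|zv] := eqVneq z v.
  apply: contraNT (Gd u v z t) => zt.
  have nt r : r \in K -> r != t by apply: contraTneq => ->.
  rewrite /diamond /= !inE !negb_or uv ![_ == z]eq_sym zu zv !nt //=.
  by rewrite ut vt zt !Ke // eq_sym.
rewrite /clique_extension; case: pickP => [[a b]|/(_ (x, y))] /=; last first.
  by rewrite xK yK xy.
case/and3P=> aK bK ab; apply/setP=> t; rewrite !inE.
case: (boolP (t \in K)) => //= tK; congr (_ && _).
by apply/andP/andP=> -[h1 h2]; split;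
  [exact: (Kt a b)|exact: (Kt a b)|exact: (Kt x y)|exact: (Kt x y)].
Qed.

(* Main.v *)
(* The proof is an uncrossing argument.  Write X = L1 :|: L2, X' = L1' :|: L2'
   for the extended cliques, with heavy components B and B', and take a
   crossing path from a in L1' to a' in L1.

   L1 and L1' are disjoint: a common vertex v would see two non-adjacent
   vertices s in L1 and s' in L1' that can be joined both through the interior
   of the crossing path and through the side of B :|: B'.  The two joins form a
   hole, and v is the centre of a clock.

   As a has no neighbour in B and a' none in B', L1 misses B' and L1' misses B.
   Hence the heavy component D of the complement of X :|: X' has its
   neighbourhood N(D) inside L2 :|: L2'.  The cliques S and S' that L2 and L2'
   cut out of N(D) are disjoint, for otherwise N(D) is a star cutset.  It
   follows that closure(S, S') stays inside (B :|: X) :&: (B' :|: X'), which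
   omits a, so it is a shield for X'. *)

Require Import Defs.
From mathcomp Require Import all_boot all_order all_algebra.
Set Implicit Arguments.
Unset Strict Implicit.
Unset Printing Implicit Defensive.
Import Order.TTheory GRing.Theory Num.Theory.
Local Open Scope ring_scope.

(** * Neighbourhoods and cliques *)

Lemma nbr_setP (T : finType) (e : rel T) (S : {set T}) (x : T) :
  reflect (x \notin S /\ exists2 y, y \in S & e x y) (x \in nbr_set e S).
Proof.
rewrite inE; apply: (iffP andP) => -[xS].
  by case/exists_inP=> y yS xy; split=> //; exists y.
by case=> y yS xy; split=> //; apply/exists_inP; exists y.
Qed.

Lemma cliqueP (T : finType) (e : rel T) (K : {set T}) :
  reflect {in K &, forall x y, x != y -> e x y} (clique e K).
Proof.
apply: (iffP forall_inP) => [Kc x y xK yK xy|Kc x xK].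
  by move/forall_inP: (Kc x xK) => /(_ y yK) /implyP; apply.
by apply/forall_inP=> y yK; apply/implyP; apply: Kc.
Qed.

Lemma card_clique_le (T : finType) (e : rel T) (K : {set T}) :
  clique e K -> (#|K| <= clique_number e)%N.
Proof. by move=> Kc; rewrite /clique_number (leq_bigmax_cond K). Qed.

Lemma clique_subset (T : finType) (e : rel T) (K L : {set T}) :
  K \subset L -> clique e L -> clique e K.
Proof.
by move=> /subsetP KL /cliqueP Lc; apply/cliqueP=> x y /KL xL /KL; apply: Lc.
Qed.

(** * Components of induced subgraphs *)

Section Components.
Variables (T : finType) (e : rel T).
Hypothesis e_sym : symmetric e.
Implicit Types S D E : {set T}.

Lemma induced_sym S : symmetric (induced e S).
Proof. by move=> x y; rewrite /induced /= e_sym [(x \in S) && _]andbC. Qed.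

Lemma closed_path S D x p :
  {in D & S, forall y z, e y z -> z \in D} -> x \in D ->
  path (induced e S) x p -> path (induced e D) x p /\ last x p \in D.
Proof.
move=> Dcl; elim: p x => [|y p IHp] x xD //= /andP[/and3P[xy xS yS] py].
have yD := Dcl _ _ xD yS xy.
by have [-> ->] := IHp y yD py; rewrite /induced /= xy xD yD.
Qed.

Lemma component_closed S D :
  D \in components e S -> {in D & S, forall y z, e y z -> z \in D}.
Proof.
case/imsetP=> x xS -> y z; rewrite !inE => /andP[yS xy] zS yz; rewrite zS /=.
by apply: connect_trans xy (connect1 _); rewrite /induced /= yz yS.
Qed.

Lemma component_subset S D : D \in components e S -> D \subset S.
Proof. by case/imsetP=> x xS ->; apply/subsetP=> y; rewrite inE => /andP[]. Qed.

Lemma mem_component S x :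
  x \in S -> exists2 D, D \in components e S & x \in D.
Proof.
move=> xS; exists [set y in S | connect (induced e S) x y].
  exact: imset_f.
by rewrite inE xS /=; exact: connect0.
Qed.

Lemma component_neq0 S D : D \in components e S -> exists x, x \in D.
Proof.
case/imsetP=> x xS ->; exists x; rewrite inE xS; exact: connect0.
Qed.

Lemma component_connected S D : D \in components e S -> connected e D.
Proof.
move=> DS; have Dcl := component_closed DS.
apply/forall_inP=> y yD; apply/forall_inP=> z zD.
have: connect (induced e S) y z.
  case/imsetP: DS yD zD => x _ ->; rewrite !inE => /andP[_ xy] /andP[_ xz].
  apply: connect_trans xz; rewrite sym_connect_sym //; exact: induced_sym.
case/connectP=> p pp ->; apply/connectP; exists p => //.
by have [] := closed_path Dcl yD pp.
Qed.

(** A path within [E] that starts at the common vertex can never leave [D], as [D] is closed under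
    adjacency inside [S]. *)
Lemma connected_subset_closed S D E :
  {in D & S, forall y z, e y z -> z \in D} -> connected e E -> E \subset S ->
  (exists2 z, z \in E & z \in D) -> E \subset D.
Proof.
move=> Dcl /forall_inP Ec /subsetP ES [z zE zD]; apply/subsetP=> y yE.
move/forall_inP: (Ec z zE) => /(_ y yE) /connectP[p pp ->].
apply: (proj2 (closed_path Dcl zD _)).
by apply: sub_path pp => u t /and3P[ut /ES uS /ES tS]; rewrite /induced /= ut uS.
Qed.

Lemma mem_components S D :
  {in D & S, forall y z, e y z -> z \in D} -> connected e D -> D \subset S ->
  (exists x, x \in D) -> D \in components e S.
Proof.
move=> Dcl Dc DS [x xD]; have xS := subsetP DS x xD.
have [E ES xE] := mem_component xS.
suff <- : E = D by [].
apply/eqP; rewrite eqEsubset; apply/andP; split.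
  apply: (connected_subset_closed Dcl (component_connected ES)).
    exact: component_subset ES.
  by exists x.
by apply: (connected_subset_closed (component_closed ES)) => //; exists x.
Qed.

Lemma component_setC_nbr_set (X D : {set T}) : D \in components e (~: X) -> nbr_set e D \subset X.
Proof.
move=> DX; apply/subsetP=> x /nbr_setP[xD [y yD xy]].
apply: contraNT xD => xX; apply: (component_closed DX yD); last by rewrite e_sym.
by rewrite inE.
Qed.

Lemma component_disjoint (X D : {set T}) x : D \in components e (~: X) -> x \in D -> x \notin X.
Proof. by move=> /component_subset/subsetP DX /DX; rewrite inE. Qed.

(** Connectedness of [D] does not involve the removed set, and enclosure by [Y] gives closedness.
    The lemma carries heavy components from one separator to another. *)
Lemma component_setC (X Y D : {set T}) :
  D \in components e (~: X) -> nbr_set e D \subset Y -> D \subset ~: Y ->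
  D \in components e (~: Y).
Proof.
move=> DX /subsetP DY DsY; apply: mem_components => //.
- move=> y z yD; rewrite inE => zY yz; apply: contraNT zY => zD.
  by apply: DY; apply/nbr_setP; split=> //; exists y => //; rewrite e_sym.
- exact: component_connected DX.
- exact: component_neq0 DX.
Qed.

End Components.

(** * Induced paths, holes and clocks *)

Section Holes.
Variables (T : finType) (e : rel T).
Hypotheses (e_sym : symmetric e) (e_irr : irreflexive e).
Implicit Types (x y s t v : T) (p q : seq T).

(** Induced paths: each vertex is adjacent to its successor and to nothing later. The clause
    [x != z] is there because non-adjacency alone would let the path return to [x]. *)
Fixpoint chordless x p : bool :=
  if p is y :: p' then
    [&& e x y, all (fun z => (x != z) && ~~ e x z) p' & chordless y p']
  else true.

Lemma chordless_path x p : chordless x p -> path e x p.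
Proof. by elim: p x => //= y p IHp x /and3P[-> _ /IHp]. Qed.

Lemma chordless_uniq x p : chordless x p -> uniq (x :: p).
Proof.
elim: p x => //= y p IHp x /and3P[xy /allP xp /IHp /= ->].
rewrite andbT inE negb_or; apply/andP; split.
  by apply: contraTneq xy => ->; rewrite e_irr.
by apply/negP=> /xp; rewrite eqxx.
Qed.

Lemma chordless_infix x p y z :
  chordless x p -> y \in x :: p -> z \in x :: p -> e y z ->
  exists p1 p2, x :: p = p1 ++ [:: y, z & p2] \/ x :: p = p1 ++ [:: z, y & p2].
Proof.
elim: p x => [|u p IHp] x.
  by move=> _; rewrite !inE => /eqP-> /eqP->; rewrite e_irr.
move=> /= /and3P[xu /allP xp cp]; rewrite ![_ \in x :: _]inE.
have last_case t : t \in u :: p -> e x t -> t = u.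
  by rewrite inE => /orP[/eqP //|/xp /andP[_ /negPf->]].
case/predU1P=> [->|yp] /predU1P[->|zp] yz.
- by rewrite e_irr in yz.
- by rewrite (last_case z) //; exists [::], p; left.
- by rewrite (last_case y) ?(e_sym x) //; exists [::], p; right.
- have [p1 [p2 [->|->]]] := IHp u cp yp zp yz.
    by exists (x :: p1), p2; left.
  by exists (x :: p1), p2; right.
Qed.

(** The new path jumps from [x] to the last vertex of [u :: p] that equals [x] or is adjacent to it,
    and follows [p] from there. *)
Lemma chordless_suffix x u p : chordless u p -> has (fun z => (x == z) || e x z) (u :: p) ->
  exists p', [/\ chordless x p', last x p' = last u p & {subset p' <= u :: p}].
Proof.
elim: p u => [|u' p IHp] u cup.
  rewrite /= orbF => /orP[/eqP->|xu]; first by exists [::].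
  by exists [:: u]; split=> //=; rewrite xu.
case: (boolP (has (fun z => (x == z) || e x z) (u' :: p))) => [hp _|hp].
  case/and3P: cup => _ _ /IHp /(_ hp) [p' [cp' lp' sp']].
  by exists p'; split=> // z /sp' zp; rewrite inE zp orbT.
rewrite -cat1s has_cat (negPf hp) /= !orbF => /orP[/eqP->|xu].
  by exists (u' :: p); split=> // z zp; rewrite inE zp orbT.
exists [:: u, u' & p]; split=> //; apply/and3P; split=> //.
by move: hp; rewrite -all_predC; apply: sub_all => z /=; rewrite negb_or.
Qed.

(** Built from the far end: the tail is shortened first, then [x] is attached by
    [chordless_suffix]. *)
Lemma chordless_subpath x p : path e x p ->
  exists p', [/\ chordless x p', last x p' = last x p & {subset p' <= p}].
Proof.
elim: p x => [|y p IHp] x /=; first by exists [::].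
case/andP=> xy /IHp[p1 [cp1 lp1 sp1]].
have [|p' [cp' lp' sp']] := chordless_suffix (x := x) cp1; first by rewrite /= xy orbT.
exists p'; split=> //; first by rewrite lp'.
by move=> z /sp'; rewrite !inE => /orP[->//|/sp1->]; rewrite orbT.
Qed.

Lemma chordless_through (F : {set T}) s t :
  connected e F -> s != t -> (exists2 x, x \in F & e s x) ->
  (exists2 y, y \in F & e t y) ->
  exists2 q, chordless s (rcons q t) & {subset q <= F}.
Proof.
move=> /forall_inP Fc st [x xF sx] [y yF ty].
move/forall_inP: (Fc x xF) => /(_ y yF) /connectP[p pp yE].
have sub : {subset x :: p <= F}.
  move=> z; rewrite inE => /predU1P[->//|].
  elim: p x pp {yE sx xF} => //= u p IHp x /andP[/and3P[_ _ uF] /IHp{}IHp].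
  by rewrite inE => /predU1P[->//|].
have: path e s (rcons (x :: p) t).
  rewrite /= sx rcons_path -yE e_sym ty andbT.
  by apply: sub_path pp => u z /and3P[].
case/chordless_subpath=> p'; rewrite last_rcons; case/lastP: p' => [|q t'] [].
  by move=> _ /= stE; rewrite stE eqxx in st.
rewrite last_rcons => cq tE sq; rewrite tE in cq sq; exists q => // z zq.
have: z \in rcons (x :: p) t by apply: sq; rewrite mem_rcons inE zq orbT.
rewrite mem_rcons inE => /predU1P[zt|/sub //].
by have := chordless_uniq cq; rewrite /= rcons_uniq -zt zq andbF.
Qed.

Lemma next_infix c p1 p2 x y : uniq c -> c = p1 ++ [:: x, y & p2] -> next c x = y.
Proof.
move=> Uc cE; rewrite -(next_rot (size p1) Uc) cE rot_size_cat /= eqxx //.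
Qed.

Lemma chordless_next x p r y z : uniq (x :: p ++ r) -> chordless x p ->
  y \in x :: p -> z \in x :: p -> e y z ->
  (z == next (x :: p ++ r) y) || (y == next (x :: p ++ r) z).
Proof.
move=> U cp yp zp yz; have [p1 [p2 pE]] := chordless_infix cp yp zp yz.
apply/orP; case: pE => pE; [left|right]; apply/eqP/esym.
all: by apply: (@next_infix _ p1 (p2 ++ r)) => //; rewrite -cat_cons pE -catA.
Qed.

(* Chordless paths from s to t through E and through F close up to a hole. *)
Lemma clock_of_two_sides (E F : {set T}) s t v :
  connected e E -> connected e F -> [disjoint E & F] ->
  {in E & F, forall x y, ~~ e x y} ->
  s != t -> ~~ e s t -> s \notin E :|: F -> t \notin E :|: F ->
  (exists2 x, x \in E & e s x) -> (exists2 x, x \in E & e t x) ->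
  (exists2 x, x \in F & e s x) -> (exists2 x, x \in F & e t x) ->
  v \notin E :|: F -> e v s -> e v t -> exists c, clock e c v.
Proof.
move=> Ec Fc dEF EF st nst; rewrite !inE !negb_or.
move=> /andP[sE sF] /andP[tE tF] sxE txE sxF txF /andP[vE vF] vs vt.
have [q cq qF] := chordless_through Fc st sxF txF.
have ts : t != s by rewrite eq_sym.
have [q' cq' qE] := chordless_through Ec ts txE sxE.
have nmem (P : {set T}) (r : seq T) x : {subset r <= P} -> x \notin P -> x \notin r.
  by move=> rP; apply: contra => /rP.
have U := chordless_uniq cq; have U' := chordless_uniq cq'.
have Uc : uniq (s :: rcons q t ++ q').
  rewrite -cat_cons cat_uniq U /=.
  move: U'; rewrite /= rcons_uniq => /andP[_ /andP[sq' ->]]; rewrite andbT.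
  apply/hasPn=> x xq'; have xE := qE x xq'; rewrite /= inE mem_rcons inE !negb_or.
  rewrite (contraNneq _ sE) => [|<- //]; rewrite (contraNneq _ tE) => [|<- //] /=.
  by apply: (nmem F) => //; rewrite (disjointFr dEF).
pose c := s :: rcons q t ++ q'.
(* After this rotation the return path through [q'] is the initial stretch, so [chordless_next]
   serves both halves of the cycle. *)
have rotE : rot (size q).+1 c = t :: rcons q' s ++ q.
  by rewrite /c !cat_rcons; apply: (rot_size_cat (s :: q) (t :: q')).
(* As [s] and [t] are not adjacent, both interiors are non-empty, which gives the cycle at least
   four vertices. *)
have q0 : (0 < size q)%N by case: (q) cq => //=; rewrite (negPf nst).
have q'0 : (0 < size q')%N by case: (q') cq' => //=; rewrite e_sym (negPf nst).
have nextP x y : e x y -> (x \in s :: rcons q t) && (y \in s :: rcons q t)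
     || (x \in t :: rcons q' s) && (y \in t :: rcons q' s) ->
    (y == next c x) || (x == next c y).
  move=> xy /orP[/andP[xq yq]|/andP[xq yq]]; first exact: chordless_next.
  rewrite -!(next_rot (size q).+1 Uc) rotE; apply: chordless_next => //.
  by rewrite -rotE rot_uniq.
exists c; split; last 1 first.
- exists s, t; rewrite vs vt; split=> //; first exact: mem_head.
  by rewrite inE mem_cat mem_rcons mem_head orbT.
- split=> //.
  + by rewrite /c /= size_cat size_rcons addSn !ltnS -(prednK q0) addSn ltnS addn_gt0 q'0 orbT.
  + rewrite /c /cycle rcons_cat cat_path last_rcons.
    by rewrite (chordless_path cq) (chordless_path cq').
  + move=> x y xc yc xy; apply: nextP => //.
    have memc z : z \in c -> [|| (z == s) || (z == t), z \in q | z \in q'].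
      rewrite /c inE mem_cat mem_rcons inE -!orbA; by [].
    rewrite !inE !mem_rcons !inE.
    (* Two vertices of [c] share one of the two paths unless one lies in [q] and the other in [q'];
       [EF] excludes an edge in that case. *)
    case/or3P: (memc x xc) => [/orP[]->|xq|xq];
    case/or3P: (memc y yc) => [/orP[]->|yq|yq]; rewrite ?xq ?yq ?orbT //.
      by case/negP: (EF _ _ (qE _ yq) (qF _ xq)); rewrite e_sym.
    by case/negP: (EF _ _ (qE _ xq) (qF _ yq)).
- rewrite /c inE mem_cat mem_rcons inE !negb_or.
  rewrite (contraTneq _ vs) => [|->]; last by rewrite e_irr.
  rewrite (contraTneq _ vt) => [|->]; last by rewrite e_irr.
  by rewrite (nmem F) // (nmem E).
Qed.

End Holes.

(** * Saturated cliques in diamond-free graphs *)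

Section DiamondFree.
Variables (T : finType) (e : rel T).
Hypotheses (e_sym : symmetric e) (e_irr : irreflexive e).
Hypothesis G_diamond_free : diamond_free e.
Implicit Types B K L Z : {set T}.

Lemma edge_neq x y : e x y -> x != y.
Proof. by apply: contraTneq => ->; rewrite e_irr. Qed.

Lemma diamond_freeP x y u v :
  e x y -> e x u -> e x v -> e y u -> e y v -> u != v -> e u v.
Proof.
move=> xy xu xv yu yv uv; apply: contraNT (G_diamond_free x y u v) => nuv.
by rewrite /diamond /= !inE !negb_or uv !edge_neq // xy xu xv yu yv.
Qed.

Lemma clique_adj K x y u z : clique e K -> x \in K -> y \in K -> x != y ->
  e u x -> e u y -> z \in K -> z != u -> e u z.
Proof.
move=> /cliqueP Kc xK yK xy ux uy zK zu.
have [-> //|zx] := eqVneq z x; have [-> //|zy] := eqVneq z y.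
apply: (@diamond_freeP x y); rewrite 1?eq_sym // ?(e_sym x u) ?(e_sym y u) //.
- exact: Kc.
- by apply: Kc; rewrite // eq_sym.
- by apply: Kc; rewrite // eq_sym.
Qed.

(* L stands for c_Z(K) with K a clique contained in N(B) and Z the complement
   of B. *)
Record saturated B L : Prop := Saturated {
  saturated_clique : clique e L;
  saturated_mem : forall u x y, u \notin B -> x \in L -> y \in L -> x != y ->
    e u x -> e u y -> u \in L;
  saturated_nbr : forall x y, x \in L -> y \in L -> x != y ->
    exists2 t, t \in L & (t != x) && (t \in nbr_set e B)
}.

Lemma sub_clique_extension Z K : K \subset clique_extension e Z K.
Proof. by rewrite /clique_extension; case: pickP => // p _; apply: subsetUl. Qed.

Lemma clique_extension_mem Z K u : u \in clique_extension e Z K ->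
  u \in K \/ [/\ u \in Z & exists x y, [/\ x \in K, y \in K, x != y, e u x & e u y]].
Proof.
rewrite /clique_extension; case: pickP => [[x y] /= /and3P[xK yK xy]|_]; last by left.
rewrite !inE => /orP[->|/andP[/andP[xu yu] uZ]]; [by left|right; split=> //].
by exists x, y; split; rewrite // e_sym.
Qed.

(** If [K] has distinct vertices [x] and [y], the extension consists of [x], [y] and their common
    neighbours outside [B], a clique by diamond-freeness. Both [x] and [y] lie in [nbr_set e B], and
    one of them differs from any given vertex. If [K] has at most one vertex, the last two clauses
    are vacuous. *)
Lemma clique_extension_saturated B K : clique e K -> K \subset nbr_set e B ->
  saturated B (clique_extension e (~: B) K).
Proof.
move=> Kc /subsetP KB; rewrite /clique_extension.
case: pickP => [[x y] /= /and3P[xK yK xy]|K1]; last first.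
  have K1' x y : x \in K -> y \in K -> x = y.
    by move=> xK yK; apply/eqP/negPn/negP=> xy; have := K1 (x, y); rewrite /= xK yK xy.
  by split=> // [u|] x y; [move=> _|]; move=> /K1' h /h ->; rewrite eqxx.
set L := (X in saturated B X).
have KnB z : z \in K -> z \notin B by move/KB/nbr_setP=> [].
have exy : e x y by move/cliqueP: Kc; apply.
have LE u : (u \in L) = (u \notin B) && [|| u == x, u == y | e u x && e u y].
  rewrite !inE (e_sym x) (e_sym y).
  have [uB|uB] := boolP (u \in B); rewrite ?andbF ?orbF ?andbT /=.
    by apply: contraTF uB => /KnB.
  have [->|ux] := eqVneq u x; first by rewrite xK.
  have [->|uy] := eqVneq u y; first by rewrite yK.
  have [uK|//] := boolP (u \in K); move/cliqueP: Kc => Kc.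
  by rewrite !Kc.
have Lc : clique e L.
  apply/cliqueP=> u v; rewrite !LE => /andP[_ uL] /andP[_ vL] uv.
  case/or3P: uL uv => [/eqP->|/eqP->|/andP[ux uy]];
  case/or3P: vL => [/eqP->|/eqP->|/andP[vx vy]]; rewrite ?eqxx // => uv.
  - by rewrite e_sym.
  - by rewrite e_sym.
  - by rewrite e_sym.
  - by apply: (diamond_freeP exy); rewrite // e_sym.
have [xL yL] : x \in L /\ y \in L by rewrite !inE xK yK.
split=> // [u p r uB pL rL pr up ur|p r pL rL pr].
  rewrite LE uB /=; have [//|ux] := eqVneq u x; have [//|uy] := eqVneq u y.
  by rewrite /= !(clique_adj Lc pL rL pr up ur) // eq_sym.
have [xp|xp] := eqVneq x p; last by exists x; rewrite ?xp ?KB.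
by exists y; rewrite // -xp eq_sym xy KB.
Qed.

(** * Heavy components and closures *)

Section Closures.
Variables (R : realFieldType) (w : T -> R).
Hypothesis w_weight : weight_function w.
Implicit Types X Y D : {set T}.

(** Disjoint sets of weight above one half would together weigh more than 1. *)
Lemma weight_meet D E : 2^-1 < weight w D -> 2^-1 < weight w E ->
  exists2 z, z \in D & z \in E.
Proof.
move=> Dw Ew; suff: ~~ [disjoint D & E] by case/pred0Pn=> z /andP[]; exists z.
apply/negP=> dDE; have [w01 w1] := w_weight.
have: weight w (D :|: E) <= 1.
  rewrite -w1 /weight [leRHS](bigID (mem (D :|: E))) /= lerDl sumr_ge0 // => z _.
  by case/andP: (w01 z).
have -> : weight w (D :|: E) = weight w D + weight w E.
  by rewrite /weight -bigU //=; apply: eq_bigl => z; rewrite !inE.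
by rewrite leNgt [X in X < _](splitr 1) !mul1r ltrD.
Qed.

Lemma heavy_unbalanced X D :
  D \in components e (~: X) -> 2^-1 < weight w D -> ~~ balanced_separator e w X.
Proof.
by move=> DX Dw; apply/negP=> /forall_inP /(_ D DX); rewrite leNgt Dw.
Qed.

Lemma unbalanced_heavy X : ~~ balanced_separator e w X ->
  heavy_component e w X \in components e (~: X) /\ 2^-1 < weight w (heavy_component e w X).
Proof.
rewrite negb_forall => /existsP[D]; rewrite negb_imply -ltNge => /andP[DX Dw].
by rewrite (heavy_componentE e_sym w_weight DX Dw).
Qed.

Lemma closureE X K1 K2 D : K1 :|: K2 = X ->
  D \in components e (~: X) -> 2^-1 < weight w D ->
  Defs.closure e w K1 K2 = clique_extension e (~: D) (K1 :&: nbr_set e D)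
                  :|: clique_extension e (~: D) (K2 :&: nbr_set e D).
Proof.
move=> KX DX Dw.
rewrite /Defs.closure /= KX (heavy_componentE e_sym w_weight DX Dw) setCU.
(* The parts A and C of the canonical separation together form the complement of the heavy
   component. *)
suff -> : ~: D :&: ~: X :|: X = ~: D by [].
apply/setP=> z; rewrite !inE; have [zX|] := boolP (z \in X); last by rewrite andbT orbF.
by rewrite orbT; apply/esym/negP => /(component_disjoint DX); rewrite zX.
Qed.

(** The heavy component [B] of the complement of [K1 :|: K2] survives the passage to the closure:
    the closure contains [nbr_set e B], and it misses [B] because only vertices outside [B] are
    added. *)
Lemma closuresP X : X \in closures e w ->
  exists B L1 L2, [/\ B \in components e (~: X), 2^-1 < weight w B,
    X = L1 :|: L2, saturated B L1 & saturated B L2].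
Proof.
rewrite inE => /existsP[K1 /existsP[K2 /and4P[K1c K2c /unbalanced_heavy[]]]].
set B := heavy_component e w _ => BK Bw /eqP ->; rewrite (closureE erefl BK Bw).
have satI K : clique e K -> saturated B (clique_extension e (~: B) (K :&: nbr_set e B)).
  by move=> Kc; apply: clique_extension_saturated;
    [apply: clique_subset Kc; apply: subsetIl|apply: subsetIr].
exists B; do 2!eexists; split; first 1 last; try exact: Bw; try reflexivity.
- exact: satI.
- exact: satI.
apply: (component_setC e_sym BK).
  apply/subsetP=> z zB.
  have: z \in K1 :|: K2 by apply: (subsetP (component_setC_nbr_set e_sym BK)).
  rewrite !inE => /orP[zK|zK]; apply/orP; [left|right];
    by apply: (subsetP (sub_clique_extension _ _)); rewrite inE zK.
rewrite -disjoints_subset disjoint_sym disjoints_subset.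
have ext_sub K : clique_extension e (~: B) (K :&: nbr_set e B) \subset ~: B.
  apply/subsetP=> z /clique_extension_mem[|[//]]; rewrite !inE => /andP[_].
  by case/andP.
by rewrite subUset !ext_sub.
Qed.

Lemma closure_closures K1 K2 D : clique e K1 -> clique e K2 ->
  K1 :|: K2 = nbr_set e D -> D \in components e (~: nbr_set e D) -> 2^-1 < weight w D ->
  let Y := clique_extension e (~: D) K1 :|: clique_extension e (~: D) K2 in
  Y \in closures e w /\ D \in components e (~: Y).
Proof.
move=> K1c K2c KD DN Dw Y.
have YE : Y = Defs.closure e w K1 K2.
  rewrite (closureE KD DN Dw) /Y; congr (clique_extension _ _ _ :|: clique_extension _ _ _).
    by apply/esym/setIidPl; rewrite -KD subsetUl.
  by apply/esym/setIidPl; rewrite -KD subsetUr.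
split.
  rewrite inE; apply/existsP; exists K1; apply/existsP; exists K2.
  by rewrite K1c K2c KD (heavy_unbalanced DN Dw) YE eqxx.
apply: (component_setC e_sym DN).
  by rewrite -KD subUset !subsetU ?sub_clique_extension ?orbT.
rewrite -disjoints_subset disjoint_sym disjoints_subset.
have ext_sub K : K \subset nbr_set e D -> clique_extension e (~: D) K \subset ~: D.
  move=> /subsetP KsD; apply/subsetP=> z /clique_extension_mem[/KsD|[//]].
  by rewrite !inE => /andP[].
by rewrite subUset !ext_sub // -KD ?subsetUl ?subsetUr.
Qed.

End Closures.

End DiamondFree.

(** * Crossing paths and disjointness of cliques *)

Lemma component_nonadjacent (T : finType) (e : rel T) (X B : {set T}) x y :
  symmetric e -> B \in components e (~: X) -> x \in ~: (B :|: X) -> y \in B ->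
  ~~ e x y.
Proof.
move=> e_sym BX; rewrite !inE negb_or => /andP[xB xX] yB; apply: contra xB => xy.
by apply: (component_closed BX yB); rewrite ?inE // e_sym.
Qed.

Section Crossing.
Variables (T : finType) (e : rel T).
Hypotheses (e_sym : symmetric e) (e_irr : irreflexive e).
Implicit Types B L X : {set T}.

(* In the proof F contains the interior of the path and E contains B and B'.
   The vertex s is a neighbour t of B in L if t is attached to F; otherwise t
   itself belongs to E, and s = a' will do.  Likewise for s'. *)
Lemma crossing_cliques_disjoint B B' L L' X X' a q a' b :
  clock_free e ->
  B \in components e (~: X) -> B' \in components e (~: X') ->
  L \subset X -> L' \subset X' -> saturated e B L -> saturated e B' L' ->
  b \in B -> b \in B' ->
  a \in L' -> a \in ~: (B :|: X) -> a' \in L -> a' \in ~: (B' :|: X') ->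
  path e a (rcons q a') ->
  {subset q <= ~: (B :|: X) :&: ~: (B' :|: X')} ->
  [disjoint L & L'].
Proof.
move=> no_clock BX BX' LX LX' Ls Ls' bB bB' aL' aA a'L a'A pq qAA.
apply/pred0P=> v; apply/negP=> /andP[/= vL vL'].
have LnB B0 X0 L0 z : B0 \in components e (~: X0) -> L0 \subset X0 -> z \in L0 -> z \notin B0.
  by move=> BX0 LX0 /(subsetP LX0) zX0; apply: contraL zX0; apply: component_disjoint BX0.
have AX z B0 X0 : z \in ~: (B0 :|: X0) -> z \notin X0 by rewrite !inE negb_or => /andP[].
have AB z B0 X0 : z \in ~: (B0 :|: X0) -> z \notin B0 by rewrite !inE negb_or => /andP[].
have av : a != v by apply: contraNneq (AX _ _ _ aA) => ->; apply: (subsetP LX).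
have a'v : a' != v by apply: contraNneq (AX _ _ _ a'A) => ->; apply: (subsetP LX').
have /cliqueP Lc := saturated_clique Ls; have /cliqueP Lc' := saturated_clique Ls'.
have L'nB z : z \in L' -> z \notin B.
  move=> zL'; apply/negP=> zB; have := component_nonadjacent e_sym BX aA zB.
  by rewrite Lc' // (contraNneq _ (AB _ _ _ aA)) // => ->.
(* A second common vertex [z] would give [a] two neighbours in [L], and saturation would put [a]
   into [X]. *)
have L'nL z : z \in L' -> z != v -> z \notin L.
  move=> zL' zv; apply/negP=> zL; case/negP: (AX _ _ _ aA); apply: (subsetP LX).
  have az : a != z by apply: contraNneq (AX _ _ _ aA) => ->; apply: (subsetP LX).
  by apply: (saturated_mem Ls (AB _ _ _ aA) zL vL zv); rewrite Lc'.
(* An edge from [z] to [z'] would give [z'] the two neighbours [z] and [v] in [L]; saturation would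
   put [z'] into [L], against [L'nL]. *)
have nadj z z' : z \in L -> z != v -> z' \in L' -> z' != v -> z != z' /\ ~~ e z z'.
  move=> zL zv zL' zv'; split.
    by apply: contraNneq (L'nL z' zL' zv') => <-.
  apply: contra (L'nL z' zL' zv') => zz'.
  apply: (saturated_mem Ls (L'nB z' zL') zL vL zv); first by rewrite e_sym.
  exact: Lc'.
have [aa' naa'] := nadj a' a a'L a'v aL' av.
case: q => [|f q] in pq qAA *; first by move: pq; rewrite /= andbT e_sym (negPf naa').
set S := _ :&: _ in qAA; have fS : f \in S by apply: qAA; rewrite mem_head.
have [F FS fF] := mem_component e fS.
move: pq; rewrite /= rcons_path => /andP[af /andP[pq la']].
have lF : last f q \in F.
  apply: (proj2 (closed_path (component_closed FS) fF _)).
  elim: q f {fS fF la' af} pq qAA => //= g q IHq f /andP[fg pq] qS.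
  rewrite {1}/induced /= fg !qS ?inE ?eqxx ?orbT //= IHq // => z zq.
  by apply: qS; rewrite inE zq orbT.
have FA z : z \in F -> z \in ~: (B :|: X) /\ z \in ~: (B' :|: X').
  by move/(subsetP (component_subset FS)); rewrite /S inE => /andP[].
have LF z : z \in L -> z \notin F.
  by move/(subsetP LX)=> zX; apply/negP=> /FA[/AX]; rewrite zX.
have LF' z : z \in L' -> z \notin F.
  by move/(subsetP LX')=> zX; apply/negP=> /FA[_ /AX]; rewrite zX.
have aF : a \in nbr_set e F by apply/nbr_setP; split; [exact: LF'|exists f].
have a'F : a' \in nbr_set e F.
  by apply/nbr_setP; split; [exact: LF|exists (last f q); rewrite // e_sym].
(* Outside [U] no vertex is adjacent to [F], which keeps the future component [E] apart from [F].
   Both [B] and [B'] avoid [U] and contain [b], so they end up in the same component. *)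
pose U := F :|: nbr_set e F :|: [set v].
have subU B0 X0 : B0 \in components e (~: X0) -> v \notin B0 ->
    {in F, forall z, z \in ~: (B0 :|: X0)} -> B0 \subset ~: U.
  move=> BX0 vB0 FA0; apply/subsetP=> z zB.
  rewrite in_setC !in_setU in_set1 !negb_or -andbA; apply/and3P; split.
  - by apply: contraTN zB => /FA0/AB.
  - apply/negP=> /nbr_setP[_ [y /FA0 yA]]; rewrite e_sym.
    exact/negP/(component_nonadjacent e_sym BX0).
  - by apply: contraTneq zB => ->.
have BU : B \subset ~: U.
  by apply: (subU _ _ BX) => [|z /FA[]//]; apply: LnB BX LX vL.
have BU' : B' \subset ~: U.
  by apply: (subU _ _ BX') => [|z /FA[]//]; apply: LnB BX' LX' vL'.
have [E EU bE] := mem_component e (subsetP BU b bB).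
have Ecl := component_closed EU.
have BE : B \subset E.
  by apply: connected_subset_closed Ecl (component_connected e_sym BX) BU _; exists b.
have BE' : B' \subset E.
  by apply: connected_subset_closed Ecl (component_connected e_sym BX') BU' _; exists b.
have EnU z : z \in E -> [/\ z \notin F, z \notin nbr_set e F & z != v].
  by move/(component_disjoint EU); rewrite !in_setU in_set1 !negb_or => /andP[/andP[]].
have side B0 L0 c : B0 \subset E -> saturated e B0 L0 -> v \in L0 -> c \in L0 ->
    c != v -> c \in nbr_set e F -> {in L0, forall z, z \notin F} ->
    exists s, [/\ s \in L0, s != v, s \in nbr_set e F & exists2 y, y \in E & e s y].
  move=> BE0 [/cliqueP Lc0 _ Ln0] vL0 cL0 cv cF LF0.
  have vc : v != c by rewrite eq_sym.
  have [t tL0 /andP[tv /nbr_setP[tB [y yB ty]]]] := Ln0 v c vL0 cL0 vc.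
  have yE := subsetP BE0 y yB.
  have [tF|tF] := boolP (t \in nbr_set e F); first by exists t; split=> //; exists y.
  exists c; split=> //; exists t.
    apply: (Ecl y t) => //; last by rewrite e_sym.
    by rewrite in_setC !in_setU in_set1 !negb_or tF tv LF0.
  by apply: Lc0 => //; apply: contraNneq tF => <-.
have [s [sL sv sF sE]] := side B L a' BE Ls vL a'L a'v a'F LF.
have [s' [sL' sv' sF' sE']] := side B' L' a BE' Ls' vL' aL' av aF LF'.
have [ss' nss'] := nadj s s' sL sv sL' sv'.
have out z : z \in nbr_set e F -> z \notin E :|: F.
  move=> zF; rewrite in_setU negb_or; case/nbr_setP: (zF) => -> _; rewrite andbT.
  by apply/negP=> /EnU[_]; rewrite zF.
have [/nbr_setP[_ sf] /nbr_setP[_ sf']] := (sF, sF').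
suff [c] : exists c, clock e c v by exact: no_clock.
have vEF : v \notin E :|: F.
  by rewrite in_setU negb_or LF // andbT; apply/negP=> /EnU[_ _]; rewrite eqxx.
have dEF : [disjoint E & F].
  by rewrite disjoint_subset; apply/subsetP=> z /EnU[].
have EF : {in E & F, forall x y, ~~ e x y}.
  move=> x y /EnU[xF xnF _] yF; apply: contra xnF => xy.
  by apply/nbr_setP; split=> //; exists y.
apply: (clock_of_two_sides e_sym e_irr (component_connected e_sym EU)
  (component_connected e_sym FS) dEF EF ss' nss' (out s sF) (out s' sF')) => //.
  by apply: Lc; rewrite // eq_sym.
by apply: Lc'; rewrite // eq_sym.
Qed.

End Crossing.

(** * The neighbourhood of the heavy component and its closure *)

Lemma nbr_set_not_star (T : finType) (e : rel T) (D : {set T}) a d y :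
  symmetric e -> (forall X : {set T}, ~~ star_cutset e X) ->
  D \in components e (~: nbr_set e D) -> d \in D -> a \notin D ->
  a \notin nbr_set e D -> y \in nbr_set e D -> ~~ (nbr_set e D \subset cnbr e y).
Proof.
move=> e_sym nostar DN dD aD aN yN; set N := nbr_set e D in DN aN yN *.
apply: contra (nostar N) => sN; rewrite /star_cutset; apply/and3P; split.
- by apply/set0Pn; exists a; rewrite in_setC.
(* If the complement of [N] were connected, it would be contained in its component [D], yet [a] lies
   outside both [N] and [D]. *)
- apply: contra aD => Nc; suff /subsetP ND : ~: N \subset D by rewrite ND ?in_setC.
  apply: (connected_subset_closed (component_closed DN) Nc) => //.
  by exists d; rewrite // (subsetP (component_subset DN)).
- by apply/exists_inP; exists y.
Qed.

(** The two cliques play symmetric roles in a closure, so the one containing [z] can be listed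
    first. *)
Lemma closures_containing (R : realFieldType) (T : finType) (e : rel T) (w : T -> R)
    (X : {set T}) z :
  symmetric e -> irreflexive e -> diamond_free e -> weight_function w ->
  X \in closures e w -> z \in X ->
  exists B L1 L2, [/\ B \in components e (~: X), 2^-1 < weight w B,
    X = L1 :|: L2, saturated e B L1 & saturated e B L2] /\ z \in L1.
Proof.
move=> e_sym e_irr Gd w_weight XC zX.
have [B [L1 [L2 [BX Bw XE s1 s2]]]] := closuresP e_sym e_irr Gd w_weight XC.
move: zX; rewrite {1}XE in_setU => /orP[zL|zL].
  by exists B, L1, L2.
by exists B, L2, L1; rewrite setUC.
Qed.

(* A vertex of A' adjacent to two vertices of S forces both into X', and
   saturation of L1' then puts one of them in L2', against [disjoint]. *)
Lemma extension_sub (T : finType) (e : rel T) (B B' X X' S D L2 L1' L2' : {set T}) u :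
  symmetric e ->
  B' \in components e (~: X') ->
  D \subset B -> nbr_set e D \subset B' :|: X' -> nbr_set e D \subset B :|: X ->
  L2 \subset X -> X' = L1' :|: L2' ->
  saturated e B L2 -> saturated e B' L1' -> saturated e B' L2' ->
  S = L2 :&: nbr_set e D -> [disjoint S & L2' :&: nbr_set e D] ->
  u \in clique_extension e (~: D) S -> u \in (B :|: X) :&: (B' :|: X').
Proof.
move=> e_sym BX' DB /subsetP ND' /subsetP ND /subsetP LX XE' s2 s1' s2' SE dS.
have Smem z : z \in S -> z \in L2 /\ z \in nbr_set e D.
  by rewrite SE inE => /andP[].
case/(clique_extension_mem e_sym)=> [/Smem[_ uN]|[_ [x [y [xS yS xy ux uy]]]]].
  by rewrite inE ND // ND'.
have [[xL xN] [yL yN]] := (Smem x xS, Smem y yS).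
rewrite inE; apply/andP; split.
  rewrite in_setU; have [//|uB] := boolP (u \in B); apply: LX.
  exact: (saturated_mem s2 uB xL yL).
apply/negPn/negP=> uA; rewrite -in_setC in uA.
have uX : u \notin X' by move: uA; rewrite !inE negb_or => /andP[].
have uB : u \notin B' by move: uA; rewrite !inE negb_or => /andP[].
have inL z : z \in S -> e u z -> z \in L1'.
  move=> zS uz; have [_ zN] := Smem z zS; have := ND' z zN.
  rewrite XE' 2!in_setU => /or3P[zB|//|zL].
    by have := component_nonadjacent e_sym BX' uA zB; rewrite uz.
  by have := disjointFr dS zS; rewrite inE zL zN.
case/negP: uX; rewrite XE' inE.
by rewrite (saturated_mem s1' uB (inL x xS ux) (inL y yS uy) xy).
Qed.

Theorem theorem6p1 (R : realFieldType) (T : finType) (e : rel T) (w : T -> R)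
    (e_sym : symmetric e) (e_irr : irreflexive e)
    (G_clock_free : clock_free e) (G_diamond_free : diamond_free e)
    (no_star_cutset : forall X : {set T}, ~~ star_cutset e X)
    (w_weight : weight_function w)
    (no_small_separator : forall X : {set T},
       (#|X| <= 4 * clique_number e)%N -> ~~ balanced_separator e w X)
    (X X' : {set T})
    (X_core : X \in core e w (closures e w))
    (X'_core : X' \in core e w (closures e w)) :
  loosely_non_crossing e (canonical_separation e w X) (canonical_separation e w X').
Proof.
move: X_core; rewrite inE => /andP[XC _].
move: X'_core; rewrite inE => /andP[XC' /forall_inP Xmin'].
move=> a q a' pq _; rewrite /= ![_ \in _ :&: _]inE => /andP[aA aX'] /andP[a'A a'X] qAA.
have [B [L1 [L2 [[BX Bw XE s1 s2] a'L]]]] :=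
  closures_containing e_sym e_irr G_diamond_free w_weight XC a'X.
have [B' [L1' [L2' [[BX' Bw' XE' s1' s2'] aL']]]] :=
  closures_containing e_sym e_irr G_diamond_free w_weight XC' aX'.
have hX := heavy_componentE e_sym w_weight BX Bw.
have hX' := heavy_componentE e_sym w_weight BX' Bw'.
rewrite hX in aA qAA; rewrite hX' in a'A qAA.
have [L1X L2X] : L1 \subset X /\ L2 \subset X by rewrite XE subsetUl subsetUr.
have [L1X' L2X'] : L1' \subset X' /\ L2' \subset X' by rewrite XE' subsetUl subsetUr.
have [b bB bB'] := weight_meet w_weight Bw Bw'.
have dL : [disjoint L1 & L1'].
  exact: (crossing_cliques_disjoint e_sym e_irr G_clock_free BX BX' L1X L1X' s1 s1'
    bB bB' aL' aA a'L a'A pq qAA).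
(* Both [X] and [X'] are unions of two cliques, hence four clique numbers bound their union: the
   source of the constant 4. *)
have small : ~~ balanced_separator e w (X :|: X').
  apply: no_small_separator; rewrite XE XE'.
  have le2 K K' : clique e K -> clique e K' -> (#|K :|: K'| <= 2 * clique_number e)%N.
    move=> Kc Kc'; rewrite mul2n -addnn; apply: leq_trans (leq_card_setU _ _) _.
    by rewrite leq_add // card_clique_le.
  apply: leq_trans (leq_card_setU _ _) _; rewrite -[4%N]/(2 + 2)%N mulnDl leq_add ?le2 //.
  - exact: saturated_clique s1.
  - exact: saturated_clique s2.
  - exact: saturated_clique s1'.
  - exact: saturated_clique s2'.
have [DXX Dw] := unbalanced_heavy e_sym w_weight small.
set D := heavy_component e w _ in DXX Dw.
have Dc := component_connected e_sym DXX.
(* [D] is connected, avoids [X0], and meets [B0] because both are heavy. *)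
have subD B0 X0 : B0 \in components e (~: X0) -> 2^-1 < weight w B0 ->
    X0 \subset X :|: X' -> D \subset B0.
  move=> BX0 Bw0 X0s; apply: (connected_subset_closed (component_closed BX0) Dc).
    by apply: subset_trans (component_subset DXX) _; rewrite setCS.
  exact: (weight_meet w_weight Dw Bw0).
have DB := subD B X BX Bw (subsetUl _ _).
have DB' := subD B' X' BX' Bw' (subsetUr _ _).
have NB B0 X0 : B0 \in components e (~: X0) -> D \subset B0 -> nbr_set e D \subset B0 :|: X0.
  move=> BX0 /subsetP DB0; apply/subsetP=> z /nbr_setP[zD [y /DB0 yB zy]].
  rewrite in_setU orbC -implyNb; apply/implyP=> zX.
  by apply: (component_closed BX0 yB); rewrite ?inE // e_sym.
have ND := NB _ _ BX DB; have ND' := NB _ _ BX' DB'.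
have DN : D \in components e (~: nbr_set e D).
  apply: (component_setC e_sym DXX) => //; apply/subsetP=> z zD; rewrite inE.
  by apply/negP=> /nbr_setP[]; rewrite zD.
(* The clique [L1] contains [a'], which has no neighbour in [B']; symmetrically for [a] below. *)
have a'nB : {in L1, forall z, z \notin B'}.
  move=> z zL; apply/negP=> zB; have := component_nonadjacent e_sym BX' a'A zB.
  move/cliqueP: (saturated_clique s1) => ->//; apply: contraTneq zB => <-.
  by move: a'A; rewrite !inE negb_or => /andP[].
have anB : {in L1', forall z, z \notin B}.
  move=> z zL; apply/negP=> zB; have := component_nonadjacent e_sym BX aA zB.
  move/cliqueP: (saturated_clique s1') => ->//; apply: contraTneq zB => <-.
  by move: aA; rewrite !inE negb_or => /andP[].
pose S := L2 :&: nbr_set e D; pose S' := L2' :&: nbr_set e D.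
have SN : S :|: S' = nbr_set e D.
  rewrite -setIUl; apply/setIidPr/subsetP=> z zN; rewrite in_setU.
  (* A vertex of [nbr_set e D] outside [L2] and [L2'] lies in [B] or [L1], and in [B'] or [L1']. It
     lies in [X :|: X'], so not in both [B] and [B']; the mixed cases contradict [anB] and [a'nB],
     the last one [dL]. *)
  have := subsetP ND' z zN; have := subsetP ND z zN.
  rewrite XE XE' !in_setU => /or3P[zB|zL|->//] /or3P[zB'|zL'|->]; rewrite ?orbT //.
  - have := subsetP (component_setC_nbr_set e_sym DXX) z zN; rewrite in_setU.
    by rewrite (negPf (component_disjoint BX zB)) (negPf (component_disjoint BX' zB')).
  - by rewrite (negPf (anB z zL')) in zB.
  - by rewrite (negPf (a'nB z zL)) in zB'.
  - by rewrite (disjointFr dL zL) in zL'.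
have aBX : a \notin B :|: X by rewrite -in_setC.
have dS : [disjoint S & S'].
  (* A common vertex [z] sees all the rest of [nbr_set e D], which is covered by the cliques [S] and
     [S']. The vertex [a], lying outside [B :|: X], shows that removing this set really separates
     something from [D]. *)
  apply/pred0P=> z; apply/negP=> /andP[/= zS zS'].
  have [d dD] := component_neq0 DN.
  have aD : a \notin D by apply: contra aBX => /(subsetP DB); rewrite in_setU => ->.
  have aN : a \notin nbr_set e D by apply: contra aBX => /(subsetP ND).
  have zN : z \in nbr_set e D by rewrite -SN in_setU zS.
  have := nbr_set_not_star e_sym no_star_cutset DN dD aD aN zN.
  case/negP; apply/subsetP=> u; rewrite -SN !in_setU !inE.
  have [//|uz] := eqVneq u z; rewrite /= => /orP[]/andP[uL _]; rewrite e_sym.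
    by move/cliqueP: (saturated_clique s2) => ->//; move: zS; rewrite inE => /andP[].
  by move/cliqueP: (saturated_clique s2') => ->//; move: zS'; rewrite inE => /andP[].
have [Sc Sc'] : clique e S /\ clique e S'.
  split; apply: clique_subset (subsetIl _ _) _.
    exact: saturated_clique s2.
  exact: saturated_clique s2'.
have [YC DY] := closure_closures e_sym w_weight Sc Sc' SN DN Dw.
set Y := _ :|: _ in YC DY.
have YXX u : u \in Y -> u \in (B :|: X) :&: (B' :|: X').
  rewrite in_setU => /orP[]; first exact: (extension_sub e_sym BX' DB ND' ND L2X XE' s2 s1' s2' erefl dS).
  rewrite setIC.
  apply: (extension_sub e_sym BX DB' ND ND' L2X' XE s2' s1 s2 erefl).
  by rewrite disjoint_sym.
clearbody Y; have := Xmin' Y YC; rewrite /shield /= hX' (heavy_componentE e_sym w_weight DY Dw).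
rewrite (heavy_unbalanced DY Dw) (heavy_unbalanced BX' Bw') /=.
(* The inclusion is strict because [a] belongs to [X'] but not to [B :|: X], which contains [D] and
   [Y]. *)
case/negP; apply/orP; left; rewrite properE; apply/andP; split.
  rewrite subUset (subset_trans DB') ?subsetUl //=.
  by apply/subsetP=> u /YXX; rewrite inE => /andP[].
apply/negP=> /subsetP /(_ a); rewrite !in_setU aX' orbT => /(_ isT) /orP[aD|aY].
  by case/negP: aBX; rewrite in_setU (subsetP DB).
by have := YXX a aY; rewrite inE (negPf aBX).
Qed.
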